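(* Let $g,h:\mathbb R^n\to\mathbb R$ be convex polynomials, let $f=g-h$, let $\mathcal P\subseteq\mathbb R^n$ be a nonempty polyhedral set of the form described in the context, and suppose $f$ is bounded below on $\mathcal P$. Suppose $h$ is $\rho$-strongly convex for some $\rho>0$. Let $\{x^k\}$, $\{y^k\}$, $\{d^k\}$ be (infinite) sequences generated by the BDCA$_{\mathrm e}$ iteration (boosted DCA with exact line search, described in the context) applied to $\min_{x\in\mathcal P}f(x)$. If the sequence $\{x^k\}$ is bounded, then: (i) the sequence $\{f(x^k)\}$ is decreasing (i.e. nonincreasing) and converges to some finite value $f_{opt}$; (ii) every limit point of $\{x^k\}$ is a critical point of $\min_{x\in\mathcal P}\{g(x)-h(x)\}$; (iii) $\sum_{k=0}^\infty\|d^k\|^2<\infty$.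
   Context: The polyhedral set is $\mathcal P=\{x\in\mathbb R^n:\langle a_i,x\rangle\le b_i\ (i=1,\ldots,m),\ \langle p_j,x\rangle=q_j\ (j=1,\ldots,r)\}$ with $a_i,p_j\in\mathbb R^n$, $b_i,q_j\in\mathbb R$, assumed nonempty (not necessarily bounded). $\|\cdot\|$ is the Euclidean norm. A function $h$ is $\rho$-strongly convex if $h-\frac\rho2\|\cdot\|^2$ is convex. BDCA$_{\mathrm e}$ iteration: start from $x^0\in\mathcal P$. For $k=0,1,\ldots$: (1) choose $y^k\in\operatorname{argmin}_{x\in\mathcal P}\{g(x)-\langle\nabla h(x^k),x\rangle\}$; (2) set $d^k=y^k-x^k$; (3) set $\mathcal I(d^k)=\{i\in\{1,\ldots,m\}:\langle a_i,d^k\rangle>0\}$ and $\bar t=\min_{i\in\mathcal I(d^k)}\frac{b_i-\langle a_i,y^k\rangle}{\langle a_i,d^k\rangle}$, with $\min\emptyset=\infty$; (4) if $\bar t>0$, let $t_k$ be a (finite) minimizer of $t\mapsto f(y^k+td^k)$ over $0\le t\le\bar t$ (over $t\ge0$ if $\bar t=\infty$); otherwise set $t_k=0$; (5) set $x^{k+1}=y^k+t_kd^k$. A point $x^*\in\mathcal P$ is a critical point of $\min_{x\in\mathcal P}\{g(x)-h(x)\}$ if $\nabla h(x^* )-\nabla g(x^* )\in\mathcal N_{\mathcal P}(x^* )$, where $\mathcal N_{\mathcal P}(x^* )=\{v\in\mathbb R^n:\langle v,y-x^*\rangle\le0\ \forall y\in\mathcal P\}$. *)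

(* Defs.v *)
From HB Require Import structures.
From mathcomp Require Import all_boot all_order all_algebra.
From mathcomp Require Import all_classical all_reals all_analysis.
(* Not imported: the notations of mpoly clash with those of mathcomp-analysis. *)
From mathcomp Require mpoly.

Set Implicit Arguments.
Unset Strict Implicit.
Unset Printing Implicit Defensive.

Import Order.TTheory GRing.Theory Num.Theory.
Import numFieldNormedType.Exports.

Local Open Scope classical_set_scope.
Local Open Scope ring_scope.

Section Definitions.
Context {R : realType} {n : nat}.
Implicit Types (u v : 'rV[R]_n) (g h : 'rV[R]_n -> R) (P : set 'rV[R]_n).

Definition dot u v : R := \sum_(i < n) u 0 i * v 0 i.

(* The library norm [`|u|] on ['rV[R]_n] is the sup norm, hence a separate
   Euclidean norm; both induce the library topology of ['rV[R]_n]. *)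
Definition enorm u : R := Num.sqrt (dot u u).

Definition is_polynomial g : Prop :=
  exists p : mpoly.mpoly n R,
    forall u, g u = mpoly.meval (fun i => u 0 i) p.

Definition grad g u : 'rV[R]_n := \row_(i < n) 'D_(delta_mx 0 i) g u.

Definition convex g : Prop := convex_function [set: 'rV[R]_n] g.

Definition strongly_convex (rho : R) h : Prop :=
  convex (fun u => h u - rho / 2 * enorm u ^+ 2).

Definition polyhedron {m r : nat} (a : 'I_m -> 'rV[R]_n) (b : 'I_m -> R)
    (p : 'I_r -> 'rV[R]_n) (q : 'I_r -> R) : set 'rV[R]_n :=
  [set u | (forall i, dot (a i) u <= b i) /\ (forall j, dot (p j) u = q j)].

Definition argmin {T : Type} (A : set T) (F : T -> R) : set T :=
  [set z | A z /\ forall w, A w -> F z <= F w].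

Definition normal_cone P u : set 'rV[R]_n :=
  [set v | forall w, P w -> dot v (w - u) <= 0].

Definition critical_point P g h u : Prop :=
  P u /\ normal_cone P u (grad h u - grad g u).

(* The index set of the minimum may be empty, in which case the value is +oo. *)
Definition step_bound {m : nat} (a : 'I_m -> 'rV[R]_n) (b : 'I_m -> R)
    (y d : 'rV[R]_n) : \bar R :=
  \big[Order.min/+oo%E]_(i < m | 0 < dot (a i) d)
    ((b i - dot (a i) y) / dot (a i) d)%:E.

Record BDCAe {m r : nat} g h (a : 'I_m -> 'rV[R]_n) (b : 'I_m -> R)
    (p : 'I_r -> 'rV[R]_n) (q : 'I_r -> R)
    (x y d : nat -> 'rV[R]_n) (t : nat -> R) : Prop := {
  BDCAe_init : polyhedron a b p q (x 0%N);
  BDCAe_subproblem : forall k,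
    argmin (polyhedron a b p q)
      (fun u => g u - dot (grad h (x k)) u) (y k);
  BDCAe_direction : forall k, d k = y k - x k;
  BDCAe_linesearch : forall k,
    let tbar := step_bound a b (y k) (d k) in
    if (0 < tbar)%E then
      argmin [set s : R | 0 <= s /\ (s%:E <= tbar)%E]
        (fun s => g (y k + s *: d k) - h (y k + s *: d k)) (t k)
    else t k = 0;
  BDCAe_update : forall k, x k.+1 = y k + t k *: d k
}.

End Definitions.

(* Main.v *)
Require Import Defs.
From mathcomp Require Import all_boot all_order all_algebra.
From mathcomp Require Import all_classical all_reals all_analysis.
From mathcomp Require Import lra.
From mathcomp Require mpoly.

Set Implicit Arguments.
Unset Strict Implicit.
Unset Printing Implicit Defensive.

Import Order.TTheory GRing.Theory Num.Theory.
Import numFieldNormedType.Exports.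
Local Open Scope classical_set_scope.
Local Open Scope ring_scope.

(** Put [f = g - h]. Comparing [y k] with the feasible point [x k] in the
    subproblem gives [g (y k) <= g (x k) + <grad h (x k), d k>], and strong
    convexity gives
    [h (y k) >= h (x k) + <grad h (x k), d k> + rho / 2 * |d k|^2];
    subtracting, [f (y k) <= f (x k) - rho / 2 * |d k|^2]. The bound on the
    step length is exactly what keeps [x k.+1] in the polyhedron, so the
    iterates are feasible, and the line search, which may choose the step 0,
    does not increase [f]. Hence [f] drops by at least [rho / 2 * |d k|^2] per
    iteration ([BDCAe_descent]). As [f] is bounded below on the polyhedron,
    [f (x k)] converges, and telescoping bounds the sum of the [|d k|^2].

    For a cluster point [z], the optimality of [y k] against a fixed feasible
    [w] reads
    [g (x k + d k) - <grad h (x k), x k + d k - w> <= g w].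
    The left-hand side is continuous in the pair [(x k, d k)] and [d k] tends
    to 0, so the inequality survives at [(z, 0)]: [z] minimizes
    [g - <grad h z, .>] over the polyhedron ([BDCAe_critical]). The first-order
    condition for this minimization is the criticality of [z]
    ([argmin_normal_cone]).

    The polynomials enter only through their continuous differentiability
    ([polynomial_C1]). *)

(** * Continuously differentiable functions *)

(** Asking for differentiability everywhere together with continuity of every
    directional derivative keeps the class visibly closed under sums and
    products; it amounts to continuous differentiability in finite
    dimension. *)
Definition C1 {R : realType} {V : normedModType R} (F : V -> R) : Prop :=
  (forall x, differentiable F x) /\ (forall v, continuous (fun x => 'D_v F x)).

Lemma C1_cst {R : realType} {V : normedModType R} (c : R) :
  C1 (fun _ : V => c).
Proof.
split=> [x|v]; first exact: differentiable_cst.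
have -> : (fun x => 'D_v (fun=> c) x) = cst (0 : R).
  by apply/funext => x; rewrite derive_cst.
exact: cst_continuous.
Qed.

Lemma C1_add {R : realType} {V : normedModType R} (F G : V -> R) :
  C1 F -> C1 G -> C1 (fun x => F x + G x).
Proof.
move=> [dF cF] [dG cG]; split=> [x|v]; first exact: differentiableD.
have -> : (fun x => 'D_v (fun x => F x + G x) x) =
          (fun x => 'D_v F x + 'D_v G x).
  by apply/funext => x; rewrite (deriveD (diff_derivable _) (diff_derivable _)).
by move=> x; apply: cvgD; [exact: cF|exact: cG].
Qed.

Lemma C1_mul {R : realType} {V : normedModType R} (F G : V -> R) :
  C1 F -> C1 G -> C1 (fun x => F x * G x).
Proof.
move=> [dF cF] [dG cG]; split=> [x|v]; first exact: differentiableM.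
have -> : (fun x => 'D_v (fun x => F x * G x) x) =
          (fun x => F x * 'D_v G x + G x * 'D_v F x).
  by apply/funext => x; rewrite (deriveM (diff_derivable _) (diff_derivable _)).
move=> x; apply: cvgD; apply: cvgM.
- exact: differentiable_continuous.
- exact: cG.
- exact: differentiable_continuous.
- exact: cF.
Qed.

Lemma C1_sum {R : realType} {V : normedModType R} {I : Type} (s : seq I)
    (F : I -> V -> R) :
  (forall i, C1 (F i)) -> C1 (fun x => \sum_(i <- s) F i x).
Proof.
move=> FC1; elim: s => [|i s IHs].
  by under eq_fun do rewrite big_nil; exact: C1_cst.
by under eq_fun do rewrite big_cons; exact: C1_add.
Qed.

Lemma C1_prod {R : realType} {V : normedModType R} {I : Type} (s : seq I)
    (F : I -> V -> R) :
  (forall i, C1 (F i)) -> C1 (fun x => \prod_(i <- s) F i x).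
Proof.
move=> FC1; elim: s => [|i s IHs].
  by under eq_fun do rewrite big_nil; exact: C1_cst.
by under eq_fun do rewrite big_cons; exact: C1_mul.
Qed.

Lemma C1_exp {R : realType} {V : normedModType R} (F : V -> R) (k : nat) :
  C1 F -> C1 (fun x => F x ^+ k).
Proof.
move=> FC1; elim: k => [|k IHk].
  by under eq_fun do rewrite expr0; exact: C1_cst.
by under eq_fun do rewrite exprS; exact: C1_mul.
Qed.

Lemma C1_coord {R : realType} {n : nat} (i : 'I_n) :
  C1 (fun u : 'rV[R]_n => u 0 i).
Proof.
split=> [x|v]; first exact: (differentiable_coord x 0 i).
(* The difference quotient of a linear form does not depend on the base
   point. *)
have -> : (fun x : 'rV[R]_n => 'D_v (fun u : 'rV[R]_n => u 0 i : R) x) =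
          cst ('D_v (fun u : 'rV[R]_n => u 0 i : R) 0).
  apply/funext => x; rewrite /derive /=.
  under eq_fun do rewrite !mxE addrK.
  by under [in RHS]eq_fun do rewrite !mxE addr0 subr0.
exact: cst_continuous.
Qed.

Lemma polynomial_C1 {R : realType} {n : nat} (F : 'rV[R]_n -> R) :
  is_polynomial F -> C1 F.
Proof.
move=> [p Fp].
have -> : F = fun u => \sum_(m <- mpoly.msupp p)
    mpoly.mcoeff m p *
    \prod_(i <- index_enum 'I_n) u 0 i ^+ (mpoly.fun_of_multinom m i).
  by apply/funext => u; rewrite Fp mpoly.mevalE.
apply: C1_sum => m; apply: C1_mul; first exact: C1_cst.
by apply: C1_prod => i; apply: C1_exp; exact: C1_coord.
Qed.

(** * The Euclidean inner product and the gradient *)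

Section EuclideanSpace.
Context {R : realType} {n : nat}.
Implicit Types (u v w : 'rV[R]_n) (F : 'rV[R]_n -> R).

Lemma dotC u v : dot u v = dot v u.
Proof. by apply: eq_bigr => i _; rewrite mulrC. Qed.

Lemma dotDr u v w : dot u (v + w) = dot u v + dot u w.
Proof.
by rewrite /dot -big_split; apply: eq_bigr => i _; rewrite mxE mulrDr.
Qed.

Lemma dotZr u c v : dot u (c *: v) = c * dot u v.
Proof.
by rewrite /dot mulr_sumr; apply: eq_bigr => i _; rewrite mxE mulrCA.
Qed.

Lemma dotBr u v w : dot u (v - w) = dot u v - dot u w.
Proof. by rewrite -scaleN1r dotDr dotZr mulN1r. Qed.

Lemma dotDl u v w : dot (u + v) w = dot u w + dot v w.
Proof. by rewrite dotC dotDr !(dotC w). Qed.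

Lemma dotBl u v w : dot (u - v) w = dot u w - dot v w.
Proof. by rewrite dotC dotBr !(dotC w). Qed.

Lemma dotZl u c v : dot (c *: u) v = c * dot u v.
Proof. by rewrite dotC dotZr dotC. Qed.

Lemma dot_ge0 u : 0 <= dot u u.
Proof. by apply: sumr_ge0 => i _; rewrite -expr2 sqr_ge0. Qed.

Lemma enorm_sqr u : enorm u ^+ 2 = dot u u.
Proof. exact/sqr_sqrtr/dot_ge0. Qed.

Lemma cvg_dot {T : Type} {FF : set_system T} {FFF : Filter FF}
    (F G : T -> 'rV[R]_n) u v :
  F s @[s --> FF] --> u -> G s @[s --> FF] --> v ->
  dot (F s) (G s) @[s --> FF] --> dot u v.
Proof.
move=> Fu Gv.
have entry (H : T -> 'rV[R]_n) w i :
    H s @[s --> FF] --> w -> H s 0 i @[s --> FF] --> w 0 i.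
  move=> Hw; apply: (cvg_comp H (fun M : 'rV[R]_n => M 0 i : R) Hw).
  exact: coord_continuous.
apply: (cvg_big add_continuous) => i _.
by apply: cvgM; exact: entry.
Qed.

Lemma cvg_row {T : Type} {FF : set_system T} {FFF : Filter FF}
    (F : T -> 'rV[R]_n) u :
  (forall i, F s 0 i @[s --> FF] --> u 0 i) -> F s @[s --> FF] --> u.
Proof.
move=> Fu; apply/cvg_ballP => eps eps0.
near=> s; split=> // i j; rewrite (ord1 i).
move: j; near: s; apply: filter_forall => j.
by have /cvg_ballP := Fu j; exact.
Unshelve. all: by end_near. Qed.

(** Entrywise convergence suffices, and each squared entry is at most the
    squared Euclidean norm. *)
Lemma cvg_dot0 {T : Type} {FF : set_system T} {FFF : Filter FF}
    (F : T -> 'rV[R]_n) :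
  dot (F s) (F s) @[s --> FF] --> (0 : R) ->
  F s @[s --> FF] --> (0 : 'rV[R]_n).
Proof.
move=> F0; apply: cvg_row => i; rewrite mxE; apply/cvgrPdist_lt => eps eps0.
near=> s; rewrite sub0r normrN.
have Fs : dot (F s) (F s) < eps ^+ 2.
  by near: s; apply: cvgr_lt F0 _ _; rewrite exprn_gt0.
rewrite -ltr_sqr ?nnegrE ?normr_ge0 ?ltW// -normrX ger0_norm ?sqr_ge0//.
apply: le_lt_trans Fs; rewrite /dot (bigD1 i)//= -expr2 lerDl.
by apply: sumr_ge0 => k _; rewrite -expr2 sqr_ge0.
Unshelve. all: by end_near. Qed.

(** Differentiability, not just existence of partial derivatives, is what
    makes the directional derivative linear in the direction. *)
Lemma derive_grad F u v : C1 F -> 'D_v F u = dot (grad F u) v.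
Proof.
move=> [dF _]; rewrite deriveE// {1}(row_sum_delta v) linear_sum/=.
apply: eq_bigr => i _; rewrite linearZ/= mxE deriveE//.
by rewrite mulrC.
Qed.

Lemma continuous_grad F : C1 F -> continuous (grad F).
Proof.
move=> [_ cF] u; apply: (@cvg_row _ _ (nbhs_filter u)) => i.
by under eq_fun do rewrite mxE; rewrite mxE; exact: cF.
Qed.

End EuclideanSpace.

(** * First-order inequalities *)

(** The difference quotient along [v] is at most [c + s * A], which tends to
    [c] as [s] decreases to 0. The quadratic slack [A] is what a strongly
    convex function produces. *)
Lemma derive_le {R : realType} {V : normedModType R} (F : V -> R) (z v : V)
    (c A : R) :
  derivable F z v ->
  (forall s, 0 < s -> s <= 1 -> F (z + s *: v) - F z <= s * c + s ^+ 2 * A) ->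
  'D_v F z <= c.
Proof.
move=> dF Fle.
have quot : s^-1 *: (F (s *: v + z) - F z) @[s --> 0^'+] --> 'D_v F z.
  by apply: cvg_dnbhs_at_right; exact: dF.
have bound : c + s * A @[s --> (0 : R)^'+] --> c + 0 * A.
  apply: cvg_at_right_filter; apply: cvgD; first exact: cvg_cst.
  by apply: cvgM; [exact: cvg_id|exact: cvg_cst].
rewrite mul0r addr0 in bound.
apply: (ler_cvg_to quot bound); near=> s.
have s0 : 0 < s by near: s; exact: nbhs_right_gt.
have s1 : s <= 1 by near: s; exact: nbhs_right_le.
rewrite -(ler_pM2l s0) /GRing.scale/= mulVKf ?gt_eqF// addrC.
rewrite [_ + z]addrC -[- _ + _]addrC (le_trans (Fle s s0 s1))//.
by rewrite mulrDr mulrA -expr2.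
Unshelve. all: by end_near. Qed.

(** Strong convexity on the segment from [u] to [w = u + v] says
    [h (u + s *: v) - h u <= s * (h w - h u) - rho / 2 * s * (1 - s) * |v|^2];
    dividing by [s] and letting [s] tend to 0 gives the claim. *)
Lemma strongly_convex_grad {R : realType} {n : nat} (rho : R)
    (h : 'rV[R]_n -> R) (u w : 'rV[R]_n) :
  C1 h -> strongly_convex rho h ->
  h u + dot (grad h u) (w - u) + rho / 2 * enorm (w - u) ^+ 2 <= h w.
Proof.
move=> hC1 hcvx; set v := w - u.
suff : 'D_v h u <= h w - h u - rho / 2 * enorm v ^+ 2.
  by rewrite derive_grad//; lra.
apply: (@derive_le _ _ _ _ _ _ (rho / 2 * enorm v ^+ 2)).
  exact/diff_derivable/hC1.1.
move=> s s0 s1.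
have := hcvx (Itv01 (ltW s0) s1) w u (in_setT _) (in_setT _).
rewrite !convRE/= /conv/= /unstable.onem !enorm_sqr.
have -> : s *: w + (1 - s) *: u = u + s *: v.
  by rewrite /v scalerBr scalerBl scale1r addrCA.
have -> : w = u + v by rewrite /v addrC subrK.
clearbody v; rewrite !(dotDr, dotDl, dotZr, dotZl) (dotC v u).
lra.
Qed.

(** Moving from the minimizer [z] towards a point [w] of [P] stays in [P], so
    the objective has a nonnegative derivative in the direction [w - z]. *)
Lemma argmin_normal_cone {R : realType} {n : nat} (P : set 'rV[R]_n)
    (F : 'rV[R]_n -> R) (c z : 'rV[R]_n) :
  (forall u w s, P u -> P w -> 0 <= s -> s <= 1 -> P (u + s *: (w - u))) ->
  C1 F -> argmin P (fun u => F u - dot c u) z -> normal_cone P z (c - grad F z).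
Proof.
move=> Pcvx FC1 [Pz zmin] w Pw; set v := w - z.
have dF : derivable F z v by exact/diff_derivable/FC1.1.
suff : 'D_v (- F) z <= - dot c v.
  by rewrite deriveN// derive_grad// dotBl; lra.
apply: (@derive_le _ _ _ _ _ _ 0); first exact: derivableN dF.
move=> s s0 s1; have := zmin _ (Pcvx z w s Pz Pw (ltW s0) s1).
by rewrite -/v !fctE dotDr dotZr; lra.
Qed.

(** * Cluster points *)

(** A strict violation at [(z, l)] would persist on a product neighborhood;
    [e k] is eventually in its second factor, and then [x k] is still in the
    first one for some [k]. *)
Lemma cluster_cvg_le {R : realType} {V W : topologicalType}
    (x : nat -> V) (e : nat -> W) (z : V) (l : W) (Phi : V * W -> R) (c : R) :
  cluster (x @ \oo) z -> e k @[k --> \oo] --> l ->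
  {for (z, l), continuous Phi} ->
  (forall k, Phi (x k, e k) <= c) -> Phi (z, l) <= c.
Proof.
move=> xz el cPhi Phi_le; rewrite leNgt; apply/negP => /(cvgr_gt _ cPhi).
move=> [[A B] /= [Az Bl] AB].
have xK : (x @ \oo) (x @` [set k | B (e k)]).
  by have [N _ NB] := el _ Bl; exists N => // k Nk; exists k => //; exact: NB.
have [_ [[k Bk <-] Axk]] := xz _ _ xK Az.
by have := AB (x k, e k) (conj Axk Bk); rewrite /= ltNge Phi_le.
Qed.

(** * Polyhedra and the step bound *)

Section Polyhedra.
Context {R : realType} {n m r : nat}.
Variables (a : 'I_m -> 'rV[R]_n) (b : 'I_m -> R).
Variables (p : 'I_r -> 'rV[R]_n) (q : 'I_r -> R).
Let P := polyhedron a b p q.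

Lemma polyhedron_segment (u w : 'rV[R]_n) (s : R) :
  P u -> P w -> 0 <= s -> s <= 1 -> P (u + s *: (w - u)).
Proof.
move=> [au pu] [aw pw] s0 s1; split=> [i|j].
  rewrite dotDr dotZr dotBr.
  have := au i; have := aw i; nra.
by rewrite dotDr dotZr dotBr pu pw subrr mulr0 addr0.
Qed.

(** A constraint [i] can only become violated along [w - u] if the inner
    product with [a i] is positive, and then [i] takes part in the minimum that
    defines the step bound. Equality constraints are kept since both [u] and
    [w] satisfy them. *)
Lemma polyhedron_step (u w : 'rV[R]_n) (s : R) :
  P u -> P w -> 0 <= s -> (s%:E <= step_bound a b w (w - u)%R)%E ->
  P (w + s *: (w - u)).
Proof.
move=> [au pu] [aw pw] s0 sle; split=> [i|j]; last first.
  by rewrite dotDr dotZr dotBr pu pw subrr mulr0 addr0.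
rewrite dotDr dotZr; have [ad|ad] := ltP 0 (dot (a i) (w - u)).
  rewrite -lerBrDl -ler_pdivlMr// -lee_fin (le_trans sle)//.
  exact: bigmin_le_cond.
by apply: le_trans (aw i); rewrite gerDl mulr_ge0_le0.
Qed.

Lemma polyhedron_cluster (x : nat -> 'rV[R]_n) (z : 'rV[R]_n) :
  (forall k, P (x k)) -> cluster (x @ \oo) z -> P z.
Proof.
move=> Px xz.
have dotz (c : 'rV[R]_n) e : (forall k, dot c (x k) <= e) -> dot c z <= e.
  move=> ce; pose Phi (ue : 'rV[R]_n * R) := dot c ue.1.
  apply: (@cluster_cvg_le _ _ _ x (fun=> 0 : R) z 0 Phi e xz (cvg_cst _) _ ce).
  apply: cvg_dot; [exact: cvg_cst|exact: cvg_fst].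
(* An equality constraint is the conjunction of two inequalities. *)
split=> [i|j]; first by apply: dotz => k; exact: (Px k).1.
apply/le_anti/andP; split; first by apply: dotz => k; rewrite (Px k).2.
rewrite -lerN2 -mulN1r -dotZl; apply: dotz => k.
by rewrite dotZl (Px k).2 mulN1r.
Qed.

End Polyhedra.

(** * The iteration *)

Section Iteration.
Context {R : realType} {n m r : nat}.
Variables (g h : 'rV[R]_n -> R).
Variables (a : 'I_m -> 'rV[R]_n) (b : 'I_m -> R).
Variables (p : 'I_r -> 'rV[R]_n) (q : 'I_r -> R).
Variables (rho : R) (x y d : nat -> 'rV[R]_n) (t : nat -> R).
Let f (u : 'rV[R]_n) := g u - h u.
Let P := polyhedron a b p q.
Hypothesis gC1 : C1 g.
Hypothesis hC1 : C1 h.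
Hypothesis rho0 : 0 < rho.
Hypothesis hcvx : strongly_convex rho h.
Hypothesis xydt : BDCAe g h a b p q x y d t.

Lemma BDCAe_linesearch_step k :
  P (x k) -> P (x k.+1) /\ f (x k.+1) <= f (y k).
Proof.
move=> Pxk; rewrite (BDCAe_update xydt).
have [Pyk _] := BDCAe_subproblem xydt k.
have /= := BDCAe_linesearch xydt k.
case: ifP => [tb0 [[t0 tle] tmin]|_ ->].
  split; first by move: tle; rewrite (BDCAe_direction xydt k);
    exact: polyhedron_step.
  have := tmin 0; rewrite scale0r addr0; apply.
  by split=> //; exact: ltW.
by rewrite scale0r addr0.
Qed.

Lemma BDCAe_feasible k : P (x k).
Proof.
elim: k => [|k IHk]; first exact: BDCAe_init xydt.
exact: (BDCAe_linesearch_step IHk).1.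
Qed.

(** Adding the optimality of [y k] against [x k] to the gradient inequality
    for [h] at [x k] cancels the linear terms. *)
Lemma BDCAe_descent k :
  rho / 2 * enorm (d k) ^+ 2 <= f (x k) - f (x k.+1).
Proof.
have [_ fy] := BDCAe_linesearch_step (BDCAe_feasible k).
have [_ /(_ _ (BDCAe_feasible k)) ymin] := BDCAe_subproblem xydt k.
have := strongly_convex_grad (x k) (y k) hC1 hcvx.
rewrite -(BDCAe_direction xydt k).
have : dot (grad h (x k)) (y k) =
       dot (grad h (x k)) (x k) + dot (grad h (x k)) (d k).
  by rewrite (BDCAe_direction xydt) dotBr addrC subrK.
move: fy ymin; rewrite /f; lra.
Qed.

Lemma BDCAe_nonincreasing : nonincreasing_seq (f \o x).
Proof.
apply/nonincreasing_seqP => k /=.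
rewrite -subr_ge0 (le_trans _ (BDCAe_descent k))//.
by rewrite mulr_ge0 ?sqr_ge0// divr_ge0// ltW.
Qed.

(** The limit is taken in the minimality of [y k] over the polyhedron; the
    first-order condition is derived afterwards, at [z]. *)
Lemma BDCAe_critical z :
  d k @[k --> \oo] --> (0 : 'rV[R]_n) -> cluster (x @ \oo) z ->
  critical_point P g h z.
Proof.
move=> d0 xz; have Pz := polyhedron_cluster BDCAe_feasible xz.
split=> //; apply: argmin_normal_cone => //; first exact: polyhedron_segment.
split=> // w Pw.
(* [Phi (x k, d k) <= g w] is the optimality of [y k = x k + d k] against
   [w]. *)
pose Phi (ue : 'rV[R]_n * 'rV[R]_n) :=
  g (ue.1 + ue.2) - dot (grad h ue.1) (ue.1 + ue.2 - w).
suff : Phi (z, 0) <= g w by rewrite /Phi/= addr0 dotBr; lra.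
apply: (cluster_cvg_le xz d0) => [|k].
  have sumc : ue.1 + ue.2 @[ue --> (z, 0 : 'rV[R]_n)] --> z + 0.
    by apply: cvgD; [exact: cvg_fst|exact: cvg_snd].
  apply: cvgB.
    by apply: (cvg_comp _ _ sumc); exact: (differentiable_continuous (gC1.1 _)).
  apply: cvg_dot; last by apply: cvgB sumc (cvg_cst _).
  by apply: cvg_comp; [exact: cvg_fst|exact: continuous_grad].
rewrite /Phi/= (BDCAe_direction xydt) [x k + _]addrC subrK.
have [_ /(_ _ Pw)] := BDCAe_subproblem xydt k.
by rewrite dotBr; lra.
Qed.

Hypothesis f_lb : has_lbound (f @` P).

Lemma BDCAe_cvg : cvgn (f \o x).
Proof.
apply: nonincreasing_is_cvgn; first exact: BDCAe_nonincreasing.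
have [c cP] := f_lb; exists c => _ [k _ <-]; apply: cP.
by exists (x k) => //; exact: BDCAe_feasible.
Qed.

(** [|d k|^2] is squeezed under a multiple of the decrease
    [f (x k) - f (x k.+1)], which vanishes because [f (x k)] converges. *)
Lemma BDCAe_direction_cvg0 : d k @[k --> \oo] --> (0 : 'rV[R]_n).
Proof.
apply: cvg_dot0.
have fx := BDCAe_cvg.
have gap : 2 / rho * (f (x k) - f (x k.+1)) @[k --> \oo] --> (0 : R).
  rewrite -(mulr0 (2 / rho)) -(subrr (limn (f \o x))).
  apply: cvgM; first exact: cvg_cst.
  apply: cvgB; [exact: fx|].
  exact: (eq_ind_r id fx (cvg_shiftS (f \o x) _)).
apply: (squeeze_cvgr _ (cvg_cst 0) gap); apply: nearW => k.
rewrite dot_ge0/= -enorm_sqr.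
have := BDCAe_descent k; rewrite -(ler_pM2l (divr_gt0 (ltr0Sn R 1) rho0)).
apply: le_trans; rewrite mulrA mulf_div [2 * rho]mulrC divff ?mul1r//.
by rewrite mulf_neq0 ?gt_eqF.
Qed.

Lemma BDCAe_summable : (\sum_(0 <= k <oo) (enorm (d k) ^+ 2)%:E < +oo)%E.
Proof.
have [c cP] := f_lb.
pose C := 2 / rho * (f (x 0%N) - c).
apply: (@le_lt_trans _ _ C%:E); last exact: ltry.
apply: lime_le.
  by apply: is_cvg_nneseries => k _ _; rewrite lee_fin sqr_ge0.
apply: nearW => N; rewrite sumEFin lee_fin.
have sum_le : rho / 2 * \sum_(0 <= k < N) enorm (d k) ^+ 2
    <= f (x 0%N) - f (x N).
  elim: N => [|N IHN]; first by rewrite big_nil mulr0 subrr.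
  by rewrite big_nat_recr//= mulrDr; have := BDCAe_descent N; lra.
have : c <= f (x N) by apply: cP; exists (x N) => //; exact: BDCAe_feasible.
move=> cf; rewrite -(ler_pM2l (divr_gt0 rho0 (ltr0Sn R 1))).
rewrite (le_trans sum_le)// /C mulrA mulf_div [2 * rho]mulrC divff.
  by rewrite mul1r lerB.
by rewrite mulf_neq0 ?gt_eqF.
Qed.

End Iteration.

Theorem theorem1 (R : realType) (n m r : nat)
    (g h : 'rV[R]_n -> R)
    (a : 'I_m -> 'rV[R]_n) (b : 'I_m -> R)
    (p : 'I_r -> 'rV[R]_n) (q : 'I_r -> R) (rho : R)
    (x y d : nat -> 'rV[R]_n) (t : nat -> R)
    (f := fun u : 'rV[R]_n => g u - h u)
    (P := polyhedron a b p q) :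
  is_polynomial g -> convex g ->
  is_polynomial h -> convex h ->
  P !=set0 ->
  has_lbound (f @` P) ->
  0 < rho -> strongly_convex rho h ->
  BDCAe g h a b p q x y d t ->
  (exists M : R, forall k, enorm (x k) <= M) ->
  [/\ nonincreasing_seq (f \o x) /\
      (exists fopt : R, f (x k) @[k --> \oo] --> fopt),
      (forall z : 'rV[R]_n, cluster (x @ \oo) z -> critical_point P g h z)
    & (\sum_(0 <= k <oo) (enorm (d k) ^+ 2)%:E < +oo)%E].
Proof.
move=> /polynomial_C1 gC1 _ /polynomial_C1 hC1 _ _ f_lb rho0 hcvx xydt _.
have d0 := BDCAe_direction_cvg0 hC1 rho0 hcvx xydt f_lb.
split.
- split; first exact: (BDCAe_nonincreasing hC1 rho0 hcvx xydt).
  exists (limn (f \o x)).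
  exact: (BDCAe_cvg hC1 rho0 hcvx xydt f_lb).
- by move=> z; exact: (BDCAe_critical gC1 hC1 xydt d0).
- exact: (BDCAe_summable hC1 rho0 hcvx xydt f_lb).
Qed.
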